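(* Let $f:M\to M$ be a $C^1$ partially hyperbolic diffeomorphism. Then $$h_{\mathrm{top}}(f)\le h^u_{\mathrm{top}}(f)+h^t_{\mathrm{top}}(f),$$ where $h^u_{\mathrm{top}}(f)$ is the unstable topological entropy and $h^t_{\mathrm{top}}(f)$ is the transversal topological entropy of $f$.
   Context: Setting: $M$ is a smooth, connected, compact Riemannian manifold without boundary, with Riemannian distance $d$. A $C^1$ diffeomorphism $f:M\to M$ is partially hyperbolic if there is a nontrivial $Tf$-invariant splitting $TM=E^s\oplus E^c\oplus E^u$ such that, for a suitable Riemannian metric, all unit vectors $v^\sigma\in E^\sigma_x$ ($\sigma=s,c,u$), $x\in M$, satisfy $\|T_xfv^s\|<\|T_xfv^c\|<\|T_xfv^u\|$, and $\|T_xf|_{E^s_x}\|<1$, $\|T_xf^{-1}|_{E^u_x}\|<1$. $W^u$ is the unstable foliation (tangent to $E^u$), with leaf $W^u(x)$ through $x$. $h_{\mathrm{top}}(f)$ is the usual topological entropy. $d^u$ is the metric on unstable leaves induced by the Riemannian structure; $d^u_n(x,y)=\max_{0\le j\le n-1}d^u(f^j(x),f^j(y))$; $W^u(x,\delta)$ is the open $d^u$-ball in $W^u(x)$ of center $x$ and radius $\delta$. $N^u(f,\epsilon,n,x,\delta)$ is the maximal number of points in $\overline{W^u(x,\delta)}$ with pairwise $d^u_n$-distances at least $\epsilon$. $h^u_{\mathrm{top}}(f)=\lim_{\delta\to0}\sup_{x\in M}h^u_{\mathrm{top}}(f,\overline{W^u(x,\delta)})$, where $h^u_{\mathrm{top}}(f,\overline{W^u(x,\delta)})=\lim_{\epsilon\to0}\limsup_{n\to\infty}\frac1n\log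 N^u(f,\epsilon,n,x,\delta)$. $B(x,\delta)$ is the open $d$-ball in $M$ about $x$ of radius $\delta$; $d_n(x,y)=\max_{0\le j\le n-1}d(f^j(x),f^j(y))$; $N(f,\epsilon,n,x,\delta)$ is the maximal number of points in $\overline{B(x,\delta)}$ with pairwise $d_n$-distances at least $\epsilon$. The transversal topological entropy is $h^t_{\mathrm{top}}(f)=\lim_{\delta\to0}\sup_{x\in M}h^t_{\mathrm{top}}(f,\overline{B(x,\delta)})$, where $$h^t_{\mathrm{top}}(f,\overline{B(x,\delta)})=\lim_{\epsilon\to0}\limsup_{n\to\infty}\frac1n\big[\log N(f,\epsilon,n,x,\delta)-\log N^u(f,\epsilon,n,x,\delta)\big].$$ *)

(* Defs.v *)
From HB Require Import structures.
From mathcomp Require Import all_boot all_order all_algebra.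
From mathcomp Require Import all_classical all_reals all_analysis.
Import Order.TTheory GRing.Theory Num.Theory.
Import numFieldNormedType.Exports.

Set Implicit Arguments.
Unset Strict Implicit.
Unset Printing Implicit Defensive.

Local Open Scope classical_set_scope.
Local Open Scope ring_scope.

(* [Ck_on k U f] is meant for U open in a finite-dimensional V. *)
Fixpoint Ck_on (R : realType) (V W : normedModType R) (k : nat)
    (U : set V) (f : V -> W) : Prop :=
  match k with
  | 0 => forall x, U x -> {for x, continuous f}
  | k'.+1 => (forall x, U x -> differentiable f x) /\
             forall v : V, Ck_on k' U (fun x => 'd f x v)
  end.

Definition smooth_on (R : realType) (V W : normedModType R)
    (U : set V) (f : V -> W) : Prop := forall k, Ck_on k U f.

(* A smooth structure is given by a smooth atlas with one chosen chart around
   every point a of M: [chart a] is a homeomorphism from [chart_dom a] onto an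
   open subset of R^n, with inverse [chart_inv a] (the values of [chart a] and
   [chart_inv a] outside these two open sets are irrelevant). *)
Record smooth_atlas (R : realType) (n : nat) (M : topologicalType) := SmoothAtlas {
  chart_dom : M -> set M;
  chart : M -> M -> 'rV[R]_n;
  chart_inv : M -> 'rV[R]_n -> M;
  chart_dom_open : forall a, open (chart_dom a);
  chart_dom_center : forall a, chart_dom a a;
  chart_img_open : forall a, open (chart a @` chart_dom a);
  chartK : forall a x, chart_dom a x -> chart_inv a (chart a x) = x;
  chart_continuous : forall a x, chart_dom a x -> {for x, continuous (chart a)};
  chart_inv_continuous : forall a u, (chart a @` chart_dom a) u ->
    {for u, continuous (chart_inv a)};
  chart_transition : forall a b,
    smooth_on (chart a @` (chart_dom a `&` chart_dom b)) (chart b \o chart_inv a)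
}.

Section Manifold.
Variables (R : realType) (n : nat) (M : topologicalType) (A : smooth_atlas R n M).

Notation dom := (chart_dom A).
Notation phi := (chart A).
Notation psi := (chart_inv A).

(* The tangent space T_xM is 'rV[R]_n, through the coordinates of [chart x].
   [coord_change a b y] is the differential, at the point y, of the change of
   coordinates from [chart a] to [chart b]; a tangent vector v at y (which is
   expressed in [chart y]) has coordinates [coord_change y a y v] in [chart a]. *)
Definition coord_change (a b y : M) : {linear 'rV[R]_n -> 'rV[R]_n} :=
  'd (phi b \o psi a) (phi a y).

Definition C1_map (f : M -> M) : Prop :=
  continuous f /\
  forall a b, Ck_on 1 (phi a @` (dom a `&` f @^-1` dom b)) (phi b \o f \o psi a).

Definition C1_diffeo (f finv : M -> M) : Prop :=
  [/\ cancel f finv, cancel finv f, C1_map f & C1_map finv].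

Definition tangent_map (f : M -> M) (x : M) : {linear 'rV[R]_n -> 'rV[R]_n} :=
  'd (phi (f x) \o f \o psi x) (phi x x).

Definition C1_into (V : normedModType R) (U : set V) (p : V -> M) : Prop :=
  (forall w, U w -> {for w, continuous p}) /\
  forall a, Ck_on 1 (U `&` p @^-1` dom a) (phi a \o p).

Definition diff_into (V : normedModType R) (p : V -> M) (w : V) :
  {linear V -> 'rV[R]_n} := 'd (phi (p w) \o p) w.

(* Curves are parametrized by the whole line, and only their restrictions to
   [0, 1] matter: every piecewise C^1 curve on [0, 1] becomes the restriction
   of such a curve, of the same length, after a reparametrization that stops
   at the corners and at the endpoints. *)
Definition C1_curve (c : R^o -> M) : Prop := C1_into setT c.

Definition velocity (c : R^o -> M) (t : R) : 'rV[R]_n := diff_into c t 1.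

Definition inner (g : M -> 'M[R]_n) (x : M) (v w : 'rV[R]_n) : R :=
  (v *m g x *m w^T) 0 0.

Definition tnorm (g : M -> 'M[R]_n) (x : M) (v : 'rV[R]_n) : R :=
  Num.sqrt (inner g x v v).

(* [g x] is the Gram matrix of the inner product of T_xM; smoothness says that
   the coefficients of the metric in every chart are smooth. *)
Definition riemannian_metric (g : M -> 'M[R]_n) : Prop :=
  [/\ forall x, (g x)^T = g x,
      forall x v, v != 0 -> 0 < inner g x v v &
      forall a v w, smooth_on (phi a @` dom a)
        (fun u => let y := psi a u in
           inner g y (coord_change a y y v) (coord_change a y y w) : R^o)].

Definition curve_length (g : M -> 'M[R]_n) (c : R -> M) : \bar R :=
  (\int[lebesgue_measure]_(t in `[0%R, 1%R]) (tnorm g (c t) (velocity c t))%:E)%E.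

Definition riemannian_dist (g : M -> 'M[R]_n) (x y : M) : \bar R :=
  ereal_inf [set curve_length g c | c in
    [set c : R -> M | [/\ C1_curve c, c 0 = x & c 1 = y]]].

Definition operator_norm (g : M -> 'M[R]_n) (f : M -> M) (x : M)
    (E : {vspace 'rV[R]_n}) : R :=
  sup [set tnorm g (f x) (tangent_map f x v) | v in
    [set v | v \in E /\ tnorm g x v = 1]].

(* Subbundles of TM: families of subspaces that are spanned, near every point a
   and in the coordinates of [chart a], by a continuous frame. *)
Definition continuous_subbundle (E : M -> {vspace 'rV[R]_n}) : Prop :=
  forall a, exists (d : nat) (e : 'I_d -> M -> 'rV[R]_n),
    \forall y \near a, (forall i, {for y, continuous (e i)}) /\
      basis_of (linfun (coord_change y a y) @: E y)%VS [seq e i y | i <- enum 'I_d].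

Definition invariant_subbundle (f : M -> M) (E : M -> {vspace 'rV[R]_n}) : Prop :=
  forall x, (linfun (tangent_map f x) @: E x)%VS = E (f x).

Definition tangent_splitting (Es Ec Eu : M -> {vspace 'rV[R]_n}) : Prop :=
  [/\ continuous_subbundle Es, continuous_subbundle Ec, continuous_subbundle Eu &
      forall x, directv (Es x + Ec x + Eu x)%VS /\
                (Es x + Ec x + Eu x)%VS = fullv].

(* Nontrivial: the splitting does not reduce to a single summand. *)
Definition nontrivial_splitting (Es Ec Eu : M -> {vspace 'rV[R]_n}) : Prop :=
  forall x, [/\ Es x != fullv, Ec x != fullv & Eu x != fullv].

Definition partially_hyperbolic (f finv : M -> M)
    (Es Ec Eu : M -> {vspace 'rV[R]_n}) : Prop :=
  [/\ tangent_splitting Es Ec Eu,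
      nontrivial_splitting Es Ec Eu,
      [/\ invariant_subbundle f Es, invariant_subbundle f Ec &
          invariant_subbundle f Eu] &
      exists g : M -> 'M[R]_n, riemannian_metric g /\
        let Tnorm x v := tnorm g (f x) (tangent_map f x v) in
        forall x,
        [/\ forall vs vc, vs \in Es x -> vc \in Ec x ->
              tnorm g x vs = 1 -> tnorm g x vc = 1 -> Tnorm x vs < Tnorm x vc,
            forall vc vu, vc \in Ec x -> vu \in Eu x ->
              tnorm g x vc = 1 -> tnorm g x vu = 1 -> Tnorm x vc < Tnorm x vu,
            operator_norm g f x (Es x) < 1 &
            operator_norm g finv x (Eu x) < 1]].

(* A foliation box around x: a homeomorphism h from a product of two open cubes
   (balls of the sup norm) onto a neighbourhood of x, such that every horizontal
   slice (plaque) is a C^1 immersed disc tangent to E, inside one leaf. *)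
Definition foliation_box (E : M -> {vspace 'rV[R]_n}) (W : M -> set M) (x : M)
    (k m : nat) (h : 'rV[R]_k * 'rV[R]_m -> M) : Prop :=
  let Q := ball (0 : 'rV[R]_k) 1 `*` ball (0 : 'rV[R]_m) 1 in
  [/\ h (0, 0) = x,
      set_inj Q h,
      forall p, Q p -> {for p, continuous h},
      forall O, O `<=` Q -> open O -> open (h @` O) &
      forall z, ball (0 : 'rV[R]_m) 1 z ->
        let plaque w := h (w, z) in
        C1_into (ball (0 : 'rV[R]_k) 1) plaque /\
        forall w, ball (0 : 'rV[R]_k) 1 w ->
          [/\ W (plaque 0) (plaque w), \dim (E (plaque w)) = k &
              (linfun (diff_into plaque w) @: fullv)%VS = E (plaque w)]].

(* [W x] is the leaf through x of a (continuous) foliation with C^1 leaves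
   tangent to E: the leaves partition M, they are unions of plaques, and each of
   them is connected by C^1 curves tangent to the foliation. *)
Definition foliation_tangent_to (E : M -> {vspace 'rV[R]_n}) (W : M -> set M) : Prop :=
  [/\ forall x, W x x,
      forall x y, W x y -> W y = W x,
      forall x y, W x y -> exists c : R -> M,
        [/\ C1_curve c, c 0 = x, c 1 = y &
            forall t, W x (c t) /\ velocity c t \in E (c t)] &
      forall x, exists (k m : nat) (h : 'rV[R]_k * 'rV[R]_m -> M),
        (k + m)%N = n /\ foliation_box E W x h].

(* The distance along the leaves; it is +oo between points of distinct leaves. *)
Definition leaf_dist (g : M -> 'M[R]_n) (W : M -> set M) (x y : M) : \bar R :=
  ereal_inf [set curve_length g c | c in
    [set c : R -> M | [/\ C1_curve c, c 0 = x, c 1 = y & forall t, W x (c t)]]].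

End Manifold.

Section Entropy.
Variables (R : realType) (M : topologicalType).
Local Open Scope ereal_scope.

Definition bowen_dist (f : M -> M) (D : M -> M -> \bar R) (k : nat) (x y : M) : \bar R :=
  \big[maxe/0]_(j < k) D (iter j f x) (iter j f y).

(* The maximal number of points of K with pairwise D-distances at least e. *)
Definition sep_number (D : M -> M -> \bar R) (e : R) (K : set M) : \bar R :=
  ereal_sup [set (size s)%:R%:E | s in
    [set s : seq M | [/\ uniq s, forall x, x \in s -> K x &
       forall x y, x \in s -> y \in s -> x != y -> e%:E <= D x y]]].

Definition sep_entropy (f : M -> M) (D : M -> M -> \bar R) (K : set M) : \bar R :=
  lim (limn_esup (fun k : nat =>
         (k%:R^-1)%:E * lne (sep_number (bowen_dist f D k) e K)) @[e --> (0%R : R)^'+]).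

End Entropy.

Section PartiallyHyperbolicEntropies.
Variables (R : realType) (n : nat) (M : topologicalType) (A : smooth_atlas R n M).
Variables (g : M -> 'M[R]_n) (f : M -> M) (W : M -> set M).
Local Open Scope ereal_scope.

Let d := riemannian_dist A g.
Let du := leaf_dist A g W.

Definition h_top : \bar R := sep_entropy f d setT.

Definition Mball (x : M) (delta : R) : set M := [set y | d x y < delta%:E].

Definition leaf_ball (x : M) (delta : R) : set M :=
  [set y | W x y /\ du x y < delta%:E].

Definition Nball (e : R) (k : nat) (x : M) (delta : R) : \bar R :=
  sep_number (bowen_dist f d k) e (closure (Mball x delta)).

(* [closure] is taken in M; leaf balls are relatively compact in their leaf, so
   this is also their closure for the topology of the leaf. *)
Definition Nu (e : R) (k : nat) (x : M) (delta : R) : \bar R :=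
  sep_number (bowen_dist f du k) e (closure (leaf_ball x delta)).

Definition hu_local (x : M) (delta : R) : \bar R :=
  lim (limn_esup (fun k : nat =>
         (k%:R^-1)%:E * lne (Nu e k x delta)) @[e --> (0%R : R)^'+]).

Definition hu_top : \bar R :=
  lim (ereal_sup [set hu_local x delta | x in setT] @[delta --> (0%R : R)^'+]).

(* In the definition of the transversal entropy the expressions are not monotone
   in e and delta, so that the limits e -> 0 and delta -> 0 are not known a
   priori to exist. They are read as lower limits: these are always defined,
   they coincide with the limits when the latter exist, and they bound every
   other limit value from below. *)
Definition ht_local (x : M) (delta : R) : \bar R :=
  limf_einf (fun e : R => limn_esup (fun k : nat =>
    (k%:R^-1)%:E * (lne (Nball e k x delta) - lne (Nu e k x delta)))) (0%R : R)^'+.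

Definition ht_top : \bar R :=
  limf_einf (fun delta : R => ereal_sup [set ht_local x delta | x in setT])
    (0%R : R)^'+.

End PartiallyHyperbolicEntropies.

(* Main.v *)
Require Import Defs.
From HB Require Import structures.
From mathcomp Require Import all_boot all_order all_algebra.
From mathcomp Require Import all_classical all_reals all_analysis.
Import Order.TTheory GRing.Theory Num.Theory.
Import numFieldNormedType.Exports.

(** The logarithm of the maximal number N of separated points of a ball splits
    as log N = (log N - log N^u) + log N^u, and upper limits of sequences are
    subadditive; what has to be checked is that this survives the passage from
    small balls to M and the limits in the scale e and in the radius delta.

    Fix delta > 0. Since M is compact and Riemannian balls are neighbourhoods
    ([nbhs_Mball]), finitely many balls of radius delta cover M. A separated set
    of M is a finite union of separated sets of these balls
    ([sep_number_le_cover]), and a finite sum grows no faster than its fastest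
    term ([growth_rate_le_sum]). So the growth rate on M at the scale e is at most
    that on some ball, and the latter is bounded by the local transversal entropy
    plus the local unstable entropy of that ball ([local_rate_le]).

    The limits are harmless because all the quantities except the transversal one
    are monotone: growth rates of numbers of separated points increase when e
    decreases, and local unstable entropies decrease with delta. The monotone
    terms are controlled along the whole limit, so that it suffices to have the
    transversal term close to its lower limit at arbitrarily small scales
    ([le_dadd_limf_einf_esup], used once for e and once for delta).

    A ball of the Riemannian distance contains a chart neighbourhood of its
    centre because a short segment in a chart, parametrized by the whole line in
    a C^1 way, is a short curve ([swing_curve_into_chart], [curve_length_le]).
    Infinite values are handled by the dual addition, for which a sum is +oo as
    soon as one of its terms is. *)

Set Implicit Arguments.
Unset Strict Implicit.
Unset Printing Implicit Defensive.

Local Open Scope classical_set_scope.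
Local Open Scope ring_scope.

(** * Upper and lower limits of extended reals; growth rates *)

Section ExtendedReals.
Variable R : realType.
Implicit Types x y a b : \bar R.
Local Open Scope ereal_scope.

Lemma le_real_ubP x y : (forall c : R, y < c%:E -> x <= c%:E) -> x <= y.
Proof.
move: y => [r| |] xc; last 2 first.
- exact: leey.
- rewrite leeNy_eq; move: x xc => [s| |]// xc.
    have := xc (s - 1)%R (ltNyr _); rewrite lee_fin => h.
    by move: h; rewrite lerBrDl gerDr ler10.
  by have := xc 0%R (ltNyr _).
apply/lee_addgt0Pr => e e0; rewrite -EFinD; apply: xc.
by rewrite lte_fin ltrDl.
Qed.

(** Bounding a dual sum through real numbers above both terms settles all the
    infinite cases at once: when one term is +oo there are no such numbers, but
    then the dual sum is +oo as well. *)
Lemma le_dadd_ub x y a :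
  (forall c c' : R, x < c%:E -> y < c'%:E -> a <= (c + c')%:E) ->
  a <= (x + y)%dE.
Proof.
move: x y => [r| |] [s| |] h //=; rewrite ?leey//.
- apply: le_real_ubP => c; rewrite lte_fin => rsc.
  have e0 : (0 < (c - (r + s)) / 2)%R by rewrite divr_gt0// subr_gt0.
  apply: le_trans (h (r + (c - (r + s)) / 2)%R (s + (c - (r + s)) / 2)%R _ _) _;
    rewrite ?lte_fin ?ltrDl// lee_fin addrACA -mulrDl -mulr2n.
  by rewrite -[X in (X / 2)%R]mulr_natr mulfK// addrC subrK.
- apply: le_real_ubP => c _; have := h (r + 1)%R (c - (r + 1))%R.
  by rewrite (addrC (r + 1)%R) subrK; apply; rewrite ?ltNyr// lte_fin ltrDl.
- apply: le_real_ubP => c _; have := h (c - (s + 1))%R (s + 1)%R.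
  by rewrite subrK; apply; rewrite ?ltNyr// lte_fin ltrDl.
- apply: le_real_ubP => c _; have := h c 0%R.
  by rewrite addr0; apply; rewrite ?ltNyr.
Qed.

Lemma dadd_le_fin x y (c c' : R) : x <= c%:E -> y <= c'%:E ->
  (x + y)%dE <= (c + c')%:E.
Proof.
move: x y => [r| |] [s| |]//=; rewrite ?leNye// !lee_fin; exact: lerD.
Qed.

Lemma le_dadd x x' y y' : x <= x' -> y <= y' -> (x + y)%dE <= (x' + y')%dE.
Proof.
move=> xx yy; apply: le_dadd_ub => c c' xc yc.
by apply: dadd_le_fin; apply/ltW; exact: le_lt_trans xc || exact: le_lt_trans yc.
Qed.

(** This is what replaces [x = (x - y) + y] for logarithms of numbers of
    separated points, which may be infinite. The difference is the primal one,
    as in the transversal entropy: for y = +oo it may be -oo, and only the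
    dual convention for the outer sum keeps the inequality true. *)
Lemma dadd_mulB_mul (r : R) x y : (0 <= r)%R ->
  r%:E * x <= ((r%:E * (x - y))%E + (r%:E * y)%E)%dE.
Proof.
rewrite le_eqVlt => /predU1P[<-|r0]; first by rewrite !mul0e [leRHS]/= addr0.
move: x y => [s| |] [t| |] //=; rewrite ?(gt0_muley, gt0_muleNy) ?lte_fin ?leey ?leNye//.
by rewrite lee_fin -mulrDr subrK.
Qed.

Section Limits.
Variables (T : choiceType) (X : filteredType T) (F : set_system X).
Implicit Types t u v : X -> \bar R.

Lemma limf_esup_le u b : (\forall z \near F, u z <= b) -> limf_esup u F <= b.
Proof.
move=> ub; apply: ge_ereal_inf; exists (ereal_sup (u @` [set z | u z <= b])).
  by exists [set z | u z <= b].
by apply: ge_ereal_sup => _ [z zb <-].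
Qed.

Lemma near_lt_limf_esup u b : limf_esup u F < b -> Filter F ->
  \forall z \near F, u z < b.
Proof.
move=> /ereal_inf_lt[_ [V FV <-] Vb] FF; apply: filterS FV => z Vz.
by apply: le_lt_trans Vb; apply: ereal_sup_ubound; exists z.
Qed.

Lemma limf_einf_lt_ex u b V : F V -> limf_einf u F < b ->
  exists2 z, V z & u z < b.
Proof.
move=> FV; rewrite limf_einfE => ub.
have : ereal_inf (u @` V) < b.
  by apply: le_lt_trans ub; apply: ereal_sup_ubound; exists V.
by move=> /ereal_inf_lt[_ [z Vz <-] zb]; exists z.
Qed.

Hypothesis FF : Filter F.

Lemma limf_esup_dadd t u v : (\forall z \near F, v z <= (t z + u z)%dE) ->
  limf_esup v F <= (limf_esup t F + limf_esup u F)%dE.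
Proof.
move=> vtu; apply: le_dadd_ub => c c' tc uc; apply: limf_esup_le.
have {}tc := near_lt_limf_esup tc FF; have {}uc := near_lt_limf_esup uc FF.
apply: filterS3 vtu tc uc => z vz /ltW tz /ltW uz.
exact: le_trans vz (dadd_le_fin _ _).
Qed.

(** A lower limit is enough for one of the two terms: [t] is almost at its lower
    limit at some points of every member of F, and at one of them [u] is below
    any number that exceeds its upper limit. *)
Lemma le_dadd_limf_einf_esup t u a : (\forall z \near F, a <= (t z + u z)%dE) ->
  a <= (limf_einf t F + limf_esup u F)%dE.
Proof.
move=> atu; apply: le_dadd_ub => c c' tc uc.
have [z [az uz] tz] := limf_einf_lt_ex (filterI atu (near_lt_limf_esup uc FF)) tc.
by apply: le_trans az _; apply: dadd_le_fin; exact: ltW.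
Qed.

Lemma le_limf_esup u v : (\forall z \near F, u z <= v z) ->
  limf_esup u F <= limf_esup v F.
Proof.
move=> uv; apply: le_real_ubP => c vc; apply: limf_esup_le.
have {}vc := near_lt_limf_esup vc FF.
by apply: filterS2 uv vc => z uz /ltW; exact: le_trans.
Qed.

End Limits.

Lemma near_at_right0 (e0 : R) : (0 < e0)%R ->
  \forall e \near (0%R : R)^'+, (0 < e <= e0)%R.
Proof.
move=> e00; near=> e; apply/andP; split; first by near: e; exact: nbhs_right_gt.
by near: e; exact: nbhs_right_le.
Unshelve. all: by end_near. Qed.

Lemma antitone_cvg_at0 (u : R -> \bar R) :
  (forall e1 e2, (0 < e1 <= e2)%R -> u e2 <= u e1) ->
  cvg (u e @[e --> (0%R : R)^'+]).
Proof.
move=> mono; apply/cvg_ex; eexists.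
apply: (@nonincreasing_at_right_cvge _ u 0%R (BInfty _ false)) => // e1 e2.
by rewrite !in_itv/= !andbT => e10 _ e12; apply: mono; rewrite e10.
Qed.

Lemma antitone_le_lim_at0 (u : R -> \bar R) (e0 : R) :
  (forall e1 e2, (0 < e1 <= e2)%R -> u e2 <= u e1) -> (0 < e0)%R ->
  u e0 <= lim (u e @[e --> (0%R : R)^'+]).
Proof.
move=> mono e00; apply: lime_ge; first exact: antitone_cvg_at0.
by apply: filterS (near_at_right0 e00) => e; exact: mono.
Qed.

Lemma limf_esup_le_monotone_lim_at0 (u : R -> \bar R) :
  (forall e1 e2, (0 < e1 <= e2)%R -> u e1 <= u e2) ->
  limf_esup u (0%R : R)^'+ <= lim (u e @[e --> (0%R : R)^'+]).
Proof.
move=> mono; apply: lime_ge.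
  apply/cvg_ex; eexists.
  apply: (@nondecreasing_at_right_cvge _ u 0%R (BInfty _ false)) => // e1 e2.
  by rewrite !in_itv/= !andbT => e10 _ e12; apply: mono; rewrite e10.
apply: filterS (near_at_right0 ltr01) => e0 /andP[e00 _].
by apply: limf_esup_le; apply: filterS (near_at_right0 e00) => e; exact: mono.
Qed.

Lemma le_lne x y : 0 <= x -> x <= y -> lne x <= lne y.
Proof.
move=> x0 xy; rewrite lee_lne// in_itv/= leey andbT//; exact: le_trans xy.
Qed.

Definition growth_rate (N : nat -> \bar R) : \bar R :=
  limn_esup (fun k : nat => (k%:R^-1)%:E * lne (N k)).

Lemma le_growth_rate (N N' : nat -> \bar R) :
  (forall k, 0 <= N k <= N' k) -> growth_rate N <= growth_rate N'.
Proof.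
move=> NN; apply: le_limf_esup; apply: nearW => k.
have /andP[N0 N1] := NN k.
by apply: lee_wpmul2l; [rewrite lee_fin invr_ge0|exact: le_lne].
Qed.

(** A finite sum grows no faster than the fastest of its terms: if every term is
    at most exp (k c), the sum is at most m exp (k c), and (ln m) / k vanishes
    in the limit. *)
Lemma growth_rate_le_sum (I : eqType) (l : seq I) (N : nat -> \bar R)
    (N_ : I -> nat -> \bar R) x :
  (forall k, 0 <= N k) -> (forall i k, 0 <= N_ i k) ->
  (forall k, N k <= \sum_(i <- l) N_ i k) ->
  (forall i, i \in l -> growth_rate (N_ i) <= x) ->
  growth_rate N <= x.
Proof.
move=> N0 N_0 Nsum Nx; apply: le_real_ubP => c xc; apply/lee_addgt0Pr => e e0.
have near_all : \forall k \near \oo, forall i, i \in l ->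
    (k%:R^-1)%:E * lne (N_ i k) < c%:E.
  elim: (l) Nx => [|i s IH] Nx; first by apply: nearW => k i.
  have Ni : limn_esup (fun k => (k%:R^-1)%:E * lne (N_ i k)) < c%:E.
    by apply: le_lt_trans (Nx i _) xc; exact: mem_head.
  have {}IH : \forall k \near \oo, forall j, j \in s ->
      (k%:R^-1)%:E * lne (N_ j k) < c%:E.
    by apply: IH => j js; apply: Nx; rewrite inE js orbT.
  have {}Ni := near_lt_limf_esup Ni _.
  apply: filterS2 IH (Ni _) => k IHk Nik j; rewrite inE => /predU1P[->//|].
  exact: IHk.
(* The successor keeps m positive when there are no terms at all. *)
pose m := (size l).+1.
have m0 : (0 < m%:R :> R)%R by [].
apply: limf_esup_le.
have near_big := nbhs_infty_gtr (Num.max 0 (ln (m%:R : R) / e))%R.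
apply: filterS2 near_all near_big => k Nk.
rewrite gt_max => /andP[k0 mk].
have N_exp i : i \in l -> N_ i k <= (expR (k%:R * c))%:E.
  move=> /Nk /ltW Nik; have kE : 0 <= (k%:R : R)%:E by rewrite lee_fin ltW.
  have := lee_wpmul2l kE Nik.
  rewrite muleA -EFinM mulfV ?gt_eqF// mul1e -EFinM.
  move=> lneN; rewrite -[N_ i k]lneK; last by rewrite in_itv/= N_0 leey.
  by rewrite -[leRHS]/(expeR (k%:R * c)%:E) lee_expeR.
have Nexp : N k <= (m%:R * expR (k%:R * c))%:E.
  apply: le_trans (Nsum k) _.
  apply: (@le_trans _ _ (\sum_(i <- l) (expR (k%:R * c))%:E)).
    by rewrite big_seq [leRHS]big_seq; apply: lee_sum => i; exact: N_exp.
  rewrite sumEFin lee_fin big_const_seq count_predT iter_addr_0 -[leLHS]mulr_natl.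
  by rewrite ler_wpM2r ?expR_ge0// ler_nat.
have lneN : lne (N k) <= (ln (m%:R : R) + k%:R * c)%:E.
  apply: le_trans (le_lne (N0 k) Nexp) _.
  by rewrite lne_EFin ?mulr_gt0 ?expR_gt0// lnM ?posrE ?expR_gt0// expRK.
apply: (@le_trans _ _ ((k%:R^-1)%:E * (ln (m%:R : R) + k%:R * c)%:E)).
  by apply: lee_wpmul2l => //; rewrite lee_fin invr_ge0 ltW.
rewrite -EFinM -EFinD lee_fin mulrDr mulKf ?gt_eqF// addrC lerD2l.
by rewrite mulrC ler_pdivrMr// mulrC -ler_pdivrMr// ltW.
Qed.

End ExtendedReals.

(** * Counting separated points *)

Section SeparatedSets.
Variables (R : realType) (M : topologicalType).
Implicit Types (D : M -> M -> \bar R) (K L : set M) (e : R).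
Local Open Scope ereal_scope.

Lemma sep_number_ge0 D e K : 0 <= sep_number D e K.
Proof. by apply: ereal_sup_ubound; exists [::]. Qed.

Lemma sep_number_subset D e K L : K `<=` L ->
  sep_number D e K <= sep_number D e L.
Proof.
move=> KL; apply: le_ereal_sup => _ [s [us sK sD] <-]; exists s => //.
by split=> // x /sK /KL.
Qed.

Lemma sep_number_antitone D e e' K : (e <= e')%R ->
  sep_number D e' K <= sep_number D e K.
Proof.
move=> ee; apply: le_ereal_sup => _ [s [us sK sD] <-]; exists s => //.
split=> // x y xs ys xy; apply: le_trans (sD x y xs ys xy).
by rewrite lee_fin.
Qed.

(** The points of a separated set that lie in one piece of a cover form a
    separated subset of that piece. *)
Lemma sep_number_le_cover (I : eqType) (l : seq I) D e K (L : I -> set M) :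
  (forall x, K x -> exists2 i, i \in l & L i x) ->
  sep_number D e K <= \sum_(i <- l) sep_number D e (L i).
Proof.
move=> KL; apply: ge_ereal_sup => _ [s [us sK sD] <-].
have {K KL sK} : forall x, x \in s -> exists2 i, i \in l & L i x.
  by move=> x /sK /KL.
elim: l s us sD => [|i l IH] s us sD sL.
  rewrite big_nil; case: s us sD sL => [//|x s] _ _ sL.
  by have [] := sL x (mem_head _ _).
rewrite big_cons -(count_predC (fun x => `[< L i x >]) s) natrD EFinD -!size_filter.
apply: leeD; last first.
  apply: IH; first exact: filter_uniq.
    by move=> x y; rewrite !mem_filter => /andP[_ xs] /andP[_ ys]; exact: sD.
  move=> x; rewrite mem_filter => /andP[/= nLx xs].
  have [j] := sL x xs; rewrite inE => /predU1P[->|jl] Ljx; last by exists j.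
  by move/asboolP : nLx.
apply: ereal_sup_ubound; exists [seq x <- s | `[< L i x >]] => //; split.
- exact: filter_uniq.
- by move=> x; rewrite mem_filter => /andP[/asboolP].
- by move=> x y; rewrite !mem_filter => /andP[_ xs] /andP[_ ys]; exact: sD.
Qed.

Variable f : M -> M.

Definition sep_rate D e K : \bar R :=
  growth_rate (fun k => sep_number (bowen_dist f D k) e K).

Lemma sep_rate_antitone D e e' K : (e <= e')%R -> sep_rate D e' K <= sep_rate D e K.
Proof.
move=> ee; apply: le_growth_rate => k.
by rewrite sep_number_ge0; exact: sep_number_antitone.
Qed.

Lemma sep_rate_subset D e K L : K `<=` L -> sep_rate D e K <= sep_rate D e L.
Proof.
move=> KL; apply: le_growth_rate => k.
by rewrite sep_number_ge0; exact: sep_number_subset.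
Qed.

Lemma sep_rate_le_entropy D e K : (0 < e)%R -> sep_rate D e K <= sep_entropy f D K.
Proof.
apply: antitone_le_lim_at0 => e1 e2 /andP[_]; exact: sep_rate_antitone.
Qed.

Lemma sep_entropy_le D K b : (forall e, (0 < e)%R -> sep_rate D e K <= b) ->
  sep_entropy f D K <= b.
Proof.
move=> rb; apply: lime_le.
  by apply: antitone_cvg_at0 => e1 e2 /andP[_]; exact: sep_rate_antitone.
by apply: filterS (near_at_right0 ltr01) => e /andP[e0 _]; exact: rb.
Qed.

Lemma sep_entropy_subset D K L : K `<=` L -> sep_entropy f D K <= sep_entropy f D L.
Proof.
move=> KL; apply: sep_entropy_le => e e0.
exact: le_trans (sep_rate_subset _ _ KL) (sep_rate_le_entropy _ _ e0).
Qed.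

End SeparatedSets.

(** * Segments in a chart, parametrized by the whole line *)

Section Swing.
Variable R : realType.
Implicit Type t : R.

(** A C^1 map of the whole line into [-1, 1] that goes from 0 to 1 on [0, 1].
    Curves in M are parametrized by the whole line, so that a straight segment
    of a chart, which would leave the chart, is run through at this pace. *)
Definition swing t : R := sin (t * (pi / 2)).

Definition swing_speed t : R := cos (t * (pi / 2)) * (pi / 2).

Lemma swing0 : swing 0 = 0.
Proof. by rewrite /swing mul0r sin0. Qed.

Lemma swing1 : swing 1 = 1.
Proof. by rewrite /swing mul1r sin_pihalf. Qed.

Lemma swing_le1 t : `|swing t| <= 1.
Proof. by rewrite /swing ler_norml sin_geN1 sin_le1. Qed.

Lemma is_derive_swing t : is_derive t (1 : R) swing (swing_speed t).
Proof.
apply: (@is_derive1_comp R sin ( *%R^~ (pi / 2))).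
apply: is_derive_eq.
by rewrite scaler0 add0r /GRing.scale/= mulr1.
Qed.

Lemma swing_speed_le t : `|swing_speed t| <= pi / 2.
Proof.
have pi2 : 0 <= pi / 2 :> R by rewrite divr_ge0 ?pi_ge0.
rewrite /swing_speed normrM (ger0_norm pi2) ler_piMl//.
by rewrite ler_norml cos_geN1 cos_le1.
Qed.

Lemma continuous_swing_speed : continuous (swing_speed : R -> R).
Proof.
move=> t; apply: (@continuousM _ R (fun t : R => cos (t * (pi / 2))) (cst (pi / 2))).
  apply: (@continuous_comp _ _ _ (fun t : R => t * (pi / 2)) cos).
    exact: mulrr_continuous.
  exact: continuous_cos.
exact: cvg_cst.
Qed.

Variable n : nat.
Implicit Types u w : 'rV[R]_n.

Lemma is_diff_swing_line u w t :
  is_diff (t : R^o) (fun r : R^o => u + swing r *: w)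
    (fun v : R^o => (v * swing_speed t) *: w).
Proof.
have dsw : differentiable (swing : R^o -> R^o) t.
  by apply/derivable1_diffP; have [] := is_derive_swing t.
have dl : differentiable (fun r : R^o => swing r *: w) t.
  exact: (@differentiableZl _ _ _ (swing : R^o -> R)).
have dlE : is_diff (t : R^o) (fun r : R^o => swing r *: w)
    (fun v : R^o => (v * swing_speed t) *: w).
  apply: DiffDef; first exact: dl.
  apply: etrans; first exact: (@diffZl _ _ _ (swing : R^o -> R)).
  apply/funext => v; rewrite (@diff1E _ _ (swing : R -> R^o))// derive1E.
  by have [_ ->] := is_derive_swing t.
have := @is_diffD _ _ _ (cst u) _ _ _ _ (is_diff_cst u (t : R^o)) dlE.
by rewrite add0r.
Qed.

End Swing.

(** * Balls of the Riemannian distance *)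

Section RiemannianBalls.
Variables (R : realType) (n : nat) (M : topologicalType) (A : smooth_atlas R n M).
Variables (g : M -> 'M[R]_n).

Notation dom := (chart_dom A).
Notation phi := (chart A).
Notation psi := (chart_inv A).

Lemma tnormZ x k v : tnorm g x (k *: v) = `|k| * tnorm g x v.
Proof.
rewrite /tnorm -sqrtr_sqr -sqrtrM ?sqr_ge0// /inner linearZ /=.
by rewrite -scalemxAr -!scalemxAl scalerA -expr2 [X in Num.sqrt X]mxE.
Qed.

Lemma inner_sum x (D : {linear 'rV[R]_n -> 'rV[R]_n}) w :
  inner g x (D w) (D w) = \sum_i \sum_j
    w 0 i * w 0 j * inner g x (D (delta_mx 0 i)) (D (delta_mx 0 j)).
Proof.
have DE : D w = \sum_i w 0 i *: D (delta_mx 0 i).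
  by rewrite {1}(row_sum_delta w) linear_sum; apply: eq_bigr => i _; rewrite linearZ.
rewrite /inner DE linear_sum !mulmx_suml summxE; apply: eq_bigr => i _.
rewrite mulmx_sumr summxE; apply: eq_bigr => j _.
by rewrite linearZ /= -scalemxAr -!scalemxAl !mxE mulrA (mulrC (w 0 j)).
Qed.

(** By bilinearity the metric at psi a u is a combination of the finitely many
    coefficients G i j u; each of them is continuous, hence bounded near the
    centre of the chart. *)
Lemma near_inner_le (a : M) : riemannian_metric A g ->
  exists2 C, 0 <= C & \forall u \near phi a a, forall w,
    inner g (psi a u) (coord_change A a (psi a u) (psi a u) w)
      (coord_change A a (psi a u) (psi a u) w) <= C * `|w| ^+ 2.
Proof.
move=> [_ _ smooth_g].
pose G (i j : 'I_n) (u : 'rV[R]_n) := inner g (psi a u)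
  (coord_change A a (psi a u) (psi a u) (delta_mx 0 i))
  (coord_change A a (psi a u) (psi a u) (delta_mx 0 j)).
have cG i j : {for phi a a, continuous (G i j : 'rV[R]_n -> R^o)}.
  apply: (smooth_g a (delta_mx 0 i) (delta_mx 0 j) 0%N).
  by exists a => //; exact: chart_dom_center.
pose S u := \sum_i \sum_j `|G i j u|.
have cS : S u @[u --> phi a a] --> S (phi a a).
  have cD := @pseudometric_normed_Zmodule.add_continuous R R^o.
  have FF := nbhs_filter (phi a a).
  apply: (@cvg_big R^o _ _ 0 _ cD _ _ _ _ _ FF) => i _.
  apply: (@cvg_big R^o _ _ 0 _ cD _ _ _ _ _ FF) => j _.
  exact: (cvg_norm (cG i j)).
exists (S (phi a a) + 1).
  by rewrite addr_ge0// sumr_ge0// => i _; exact: sumr_ge0.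
have : \forall u \near phi a a, S u < S (phi a a) + 1.
  by apply: (cvgr_lt _ cS); rewrite ltrDl.
apply: filterS => u Su w.
rewrite inner_sum (@le_trans _ _ (S u * `|w| ^+ 2))//; last first.
  by rewrite ler_wpM2r ?exprn_ge0// ltW.
rewrite mulr_suml ler_sum// => i _; rewrite mulr_suml ler_sum// => j _.
rewrite (le_trans (ler_norm _))// normrM mulrC ler_wpM2l// normrM expr2.
suff wi k : `|w 0 k| <= `|w| by rewrite ler_pM.
by rewrite {2}/Num.norm /= mx_normrE; apply: le_trans (le_bigmax _ _ (0, k)).
Qed.

(** In every other chart b the curve reads as (phi b \o psi a) \o l, so that
    the chain rule gives its differentials from those of the transition map. *)
Lemma swing_curve_into_chart a w :
  let l (t : R^o) := phi a a + swing t *: w in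
  let c (t : R^o) := psi a (l t) in
  (forall t, (phi a @` dom a) (l t)) ->
  C1_curve A c /\
  forall t, velocity A c t = swing_speed t *: coord_change A a (c t) (c t) w.
Proof.
move=> l c lO.
have dl t : is_diff (t : R^o) l (fun v : R^o => (v * swing_speed t) *: w).
  exact: is_diff_swing_line.
have cl t : {for t, continuous l}.
  by apply: differentiable_continuous; have [] := dl t.
have cc t : {for t, continuous c}.
  apply: (@continuous_comp _ _ _ l (psi a)); first exact: cl.
  exact: chart_inv_continuous (lO t).
have cdom t : dom a (c t) /\ phi a (c t) = l t.
  by have [x xa xl] := lO t; rewrite /c -xl chartK.
have lU b t : dom b (c t) -> (phi a @` (dom a `&` dom b)) (l t).
  by move=> bct; have [act <-] := cdom t; exists (c t).
have dF b t : dom b (c t) -> differentiable (phi b \o psi a) (l t).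
  by move=> /lU; have [dF _] := chart_transition A a b 1%N; exact: dF.
have dFc b t v : dom b (c t) -> 'd (phi b \o c) (t : R^o) v =
    (v * swing_speed t) *: 'd (phi b \o psi a) (l t) w.
  move=> bct; have [dlt dltE] := dl t.
  rewrite (_ : phi b \o c = (phi b \o psi a) \o l)//.
  by rewrite diff_comp//=; [rewrite dltE linearZ|exact: dF].
split; last first.
  move=> t; rewrite /velocity /diff_into dFc; last exact: chart_dom_center.
  by rewrite mul1r /coord_change; have [_ ->] := cdom t.
split=> [t _|b]; first exact: cc.
split=> [t [_ bct]|v t [_ bct]].
  rewrite (_ : phi b \o c = (phi b \o psi a) \o l)//.
  by apply: differentiable_comp; [have [] := dl t|exact: dF].
have near_b : \forall r \near t, dom b (c r).
  by apply: cc; apply: open_nbhs_nbhs; split => //; exact: chart_dom_open.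
(* The chain rule gives the value of the differential at t, and then its values
   near t, as c stays in the domain of the chart b there. *)
apply: (eq_ind_r (fun z => 'd (phi b \o c) r v @[r --> t] --> z) _
  (dFc b t v bct)).
have dFnear : \forall r \near (t : R^o),
    (v * swing_speed r) *: 'd (phi b \o psi a) (l r) w = 'd (phi b \o c) r v.
  by apply: filterS near_b => r br; exact: esym (dFc b r v br).
apply: cvg_trans (near_eq_cvg dFnear) _.
apply: cvgZ.
  by apply: cvgM; [exact: cvg_cst|exact: continuous_swing_speed].
apply: (@continuous_comp _ _ _ l (fun u => 'd (phi b \o psi a) u w)); first exact: cl.
by have [_ dF1] := chart_transition A a b 1%N; apply: dF1; exact: lU.
Qed.

(** The integral of a nonnegative function is a supremum over the simple
    functions below it, which makes it monotone by definition. *)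
Lemma curve_length_le (c : R -> M) K :
  (forall t, tnorm g (c t) (velocity A c t) <= K) ->
  (curve_length A g c <= K%:E)%E.
Proof.
move=> cK; rewrite /curve_length.
have cK0 t : 0 <= tnorm g (c t) (velocity A c t) by exact: sqrtr_ge0.
have K0 : 0 <= K by exact: le_trans (cK 0).
apply: (@le_trans _ _ (\int[lebesgue_measure]_(t in `[0%R, 1%R]) K%:E)%E); last first.
  by rewrite integral_cst//= lebesgue_measure_itv/= lte01 oppr0 adde0 mule1.
rewrite !ge0_integralE//; last by move=> t _; rewrite lee_fin.
apply: le_ereal_sup => _ [h hc <-]; exists h => // t.
by apply: le_trans (hc t) _; rewrite /patch; case: ifP => // _; rewrite lee_fin.
Qed.

(** In the chart around x, a point with coordinates close to those of x is
    reached by a segment, whose length is at most a constant times the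
    coordinate distance. *)
Lemma nbhs_Mball x delta : riemannian_metric A g -> 0 < delta ->
  nbhs x (Mball A g x delta).
Proof.
move=> met d0; have [C C0 gC] := near_inner_le x met.
have O0 : nbhs (phi x x) (phi x @` dom x).
  apply: open_nbhs_nbhs; split; first exact: chart_img_open.
  by exists x => //; exact: chart_dom_center.
have [r /= r0 rP] : exists2 r, 0 < r & forall u, ball (phi x x) r u ->
   (phi x @` dom x) u /\ forall w, inner g (psi x u)
     (coord_change A x (psi x u) (psi x u) w)
     (coord_change A x (psi x u) (psi x u) w) <= C * `|w| ^+ 2.
  by have [r ? rP] := (nbhs_ballP _ _).1 (filterI O0 gC); exists r.
pose K := pi / 2 * Num.sqrt C.
have K0 : 0 <= K by rewrite mulr_ge0 ?sqrtr_ge0// divr_ge0 ?pi_ge0.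
have near_small : \forall u \near phi x x,
    `|u - phi x x| < Num.min r (delta / (K + 1)).
  have : 0 < Num.min r (delta / (K + 1)) by rewrite lt_min r0 divr_gt0// ltr_wpDl.
  move=> /nbhsx_ballx - /(_ _ (phi x x)); apply: filterS => u.
  by rewrite -ball_normE /ball_ /= distrC.
have cphi : {for x, continuous (phi x)}.
  by apply: chart_continuous; exact: chart_dom_center.
have near_dom : \forall y \near x, dom x y.
  by apply: open_nbhs_nbhs; split; [exact: chart_dom_open|exact: chart_dom_center].
apply: filterS2 near_dom (cphi _ near_small) => y ydom.
rewrite /= lt_min => /andP[wr wd]; set w := phi x y - phi x x in wr wd.
have inball t : ball (phi x x) r (phi x x + swing t *: w).
  rewrite -ball_normE /ball_ /= opprD addNKr normrN normrZ.
  by rewrite (le_lt_trans _ wr)// ler_piMl// swing_le1.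
have [|C1c vel] := @swing_curve_into_chart x w; first by move=> t; have [] := rP _ (inball t).
set c := fun t => _ in C1c vel.
apply: (@le_lt_trans _ _ (K * `|w|)%:E); last first.
  rewrite lte_fin (le_lt_trans (y := (K + 1) * `|w|))//.
    by rewrite ler_wpM2r// lerDl.
  by rewrite mulrC -ltr_pdivlMr// ltr_wpDl.
apply: (@le_trans _ _ (curve_length A g c)).
  apply: ereal_inf_lbound; exists c => //; split => //.
    by rewrite /c swing0 scale0r addr0 chartK//; exact: chart_dom_center.
  by rewrite /c swing1 scale1r addrC subrK chartK.
apply: curve_length_le => t.
rewrite vel tnormZ /K -mulrA ler_pM ?sqrtr_ge0 ?swing_speed_le//.
have -> : Num.sqrt C * `|w| = Num.sqrt (C * `|w| ^+ 2).
  by rewrite sqrtrM// sqrtr_sqr normr_id.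
by apply: ler_wsqrtr; have [_] := rP _ (inball t); exact.
Qed.

End RiemannianBalls.

(** * From small balls to the whole manifold *)

Section LocalToGlobal.
Variables (R : realType) (n : nat) (M : topologicalType) (A : smooth_atlas R n M).
Variables (g : M -> 'M[R]_n) (f : M -> M) (W : M -> set M).
Local Open Scope ereal_scope.

Notation d := (riemannian_dist A g).

(** The rate at the fixed scale e is bounded by the rate at every smaller scale,
    in particular at those scales where the transversal rate is close to its
    lower limit; the unstable rate is at most its supremum over all scales. *)
Lemma local_rate_le x (delta e : R) : (0 < e)%R ->
  sep_rate f d e (closure (Mball A g x delta)) <=
  (ht_local A g f W x delta + hu_local A g f W x delta)%dE.
Proof.
move=> e0; apply: (@le_trans _ _ (ht_local A g f W x delta + limf_esup (fun e =>
    sep_rate f (leaf_dist A g W) e (closure (leaf_ball A g W x delta))) (0%R : R)^'+)%dE).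
  apply: le_dadd_limf_einf_esup.
  apply: filterS (near_at_right0 e0) => e' /andP[_ e'e].
  apply: le_trans (sep_rate_antitone _ _ _ e'e) _.
  apply: limf_esup_dadd; apply: nearW => k.
  by apply: dadd_mulB_mul; rewrite invr_ge0.
apply: le_dadd => //; apply: limf_esup_le.
apply: filterS (near_at_right0 e0) => e' /andP[e'0 _].
exact: sep_rate_le_entropy.
Qed.

Lemma hu_local_monotone x (delta delta' : R) : (delta <= delta')%R ->
  hu_local A g f W x delta <= hu_local A g f W x delta'.
Proof.
move=> dd; apply: sep_entropy_subset; apply: closureS => y [Wy dy]; split=> //.
by apply: lt_le_trans dy _; rewrite lee_fin.
Qed.

Hypothesis metric_g : riemannian_metric A g.
Hypothesis cptM : compact [set: M].

Lemma finite_ball_cover (delta : R) : (0 < delta)%R ->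
  exists l : seq M, forall y, exists2 x, x \in l & closure (Mball A g x delta) y.
Proof.
move=> d0.
(* The cover form of compactness is stated for pointed spaces. *)
have [[x0 _]|M0] := pselect ([set: M] !=set0); last first.
  by exists [::] => y; case: M0; exists y.
pose pM : ptopologicalType := HB.pack M (isPointed.Build M x0).
have cov_cpt : @cover_compact pM setT by rewrite -compact_cover.
have [x _||l _ cov] := cov_cpt _ setT (fun x => (Mball A g x delta)^°).
  exact: open_interior.
  by move=> x _; exists x => //; exact: nbhs_Mball.
exists (finmap.enum_fset l) => y; have [x xl yx] := cov y I.
by exists x => //; apply: subset_closure; exact: interior_subset yx.
Qed.

(** The cover by balls of radius delta is chosen before the scale e of the
    separation, so the number of balls does not affect the growth rate. *)
Lemma h_top_le_scale (delta : R) : (0 < delta)%R ->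
  h_top A g f <= (ereal_sup [set ht_local A g f W x delta | x in setT] +
                  ereal_sup [set hu_local A g f W x delta | x in setT])%dE.
Proof.
move=> d0; have [l cov] := finite_ball_cover d0.
apply: sep_entropy_le => e e0.
apply: (@growth_rate_le_sum _ _ l _
  (fun x k => sep_number (bowen_dist f d k) e (closure (Mball A g x delta)))).
- by move=> k; exact: sep_number_ge0.
- by move=> x k; exact: sep_number_ge0.
- by move=> k; apply: sep_number_le_cover => y _; exact: cov.
move=> x _; apply: le_trans (local_rate_le x delta e0) _.
by apply: le_dadd; apply: ereal_sup_ubound; exists x.
Qed.

Lemma h_top_le : h_top A g f <= (hu_top A g f W + ht_top A g f W)%dE.
Proof.
(* The transversal entropy, which is only a lower limit, comes first. *)
rewrite addrC.
apply: (@le_trans _ _ (ht_top A g f W + limf_esup (fun delta : R =>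
    ereal_sup [set hu_local A g f W x delta | x in setT]) (0%R : R)^'+)%dE).
  apply: le_dadd_limf_einf_esup.
  by apply: filterS (near_at_right0 ltr01) => delta /andP[d0 _]; exact: h_top_le_scale.
apply: le_dadd => //; apply: limf_esup_le_monotone_lim_at0 => d1 d2 /andP[_ d12].
apply: ge_ereal_sup => _ [x _ <-]; apply: le_trans (hu_local_monotone x d12) _.
by apply: ereal_sup_ubound; exists x.
Qed.

End LocalToGlobal.

(* The sum is the one of \bar R with the convention -oo + +oo = +oo; the
   convention is immaterial, since the unstable entropy is always finite. *)
Theorem corollaryC3 (R : realType) (n : nat) (M : topologicalType)
    (A : smooth_atlas R n M) (g : M -> 'M[R]_n) (f finv : M -> M)
    (Es Ec Eu : M -> {vspace 'rV[R]_n}) (Wu : M -> set M) :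
  [set: M] !=set0 -> hausdorff_space M -> compact [set: M] -> connected [set: M] ->
  riemannian_metric A g ->
  C1_diffeo A f finv ->
  partially_hyperbolic A f finv Es Ec Eu ->
  foliation_tangent_to A Eu Wu ->
  (h_top A g f <= (hu_top A g f Wu + ht_top A g f Wu)%dE)%E.
Proof.
move=> _ _ cptM _ metric_g _ _ _.
exact: h_top_le.
Qed.
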